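(* For a linear map $A:\mathbb R^m\to\mathbb R^n$ define a convex bifunction $F_A$ from $\mathbb R^m$ to $\mathbb R^n$ and a concave bifunction $G_A$ from $\mathbb R^n$ to $\mathbb R^m$ by \[ F_A(x,y)=\{|y=Ax|\},\qquad G_A(y,x)=-\{|x=A^Ty|\}. \] Then $A\mapsto F_A$ and $A\mapsto G_A$ (identity on objects) define functors of copy-delete categories \[ F:\mathtt{Vect}\to(\mathtt{CxBiFn},\bullet),\qquad G:\mathtt{Vect}\to(\mathtt{CvBiFn}^{\mathrm{op}},\circ), \] and these commute with the adjoint operation, i.e. $(F_A)^*=G_A$ and $(G_A)^*=F_A$ for every linear map $A$.
   Context: Notation: $\overline{\mathbb R}=[-\infty,+\infty]$; $\langle-,-\rangle$ is the standard inner product; $\{|P|\}$ is $0$ if $P$ holds and $+\infty$ otherwise. A function into $\overline{\mathbb R}$ is convex if its epigraph is convex, concave if its negative is convex. A convex (concave) bifunction from $\mathbb R^m$ to $\mathbb R^n$ is a jointly convex (concave) function $\mathbb R^m\times\mathbb R^n\to\overline{\mathbb R}$. $\mathtt{CxBiFn}$: objects $\mathbb R^n$ ($n\ge0$), morphisms $\mathbb R^m\to\mathbb R^n$ the convex bifunctions, identities $\{|x=y|\}$, composition $(F\circ G)(x,z)=\inf_y\{G(x,y)+F(y,z)\}$. $\mathtt{CvBiFn}$: concave bifunctions, identities $-\{|x=y|\}$, composition $(F\circ G)(x,z)=\sup_y\{G(x,y)+F(y,z)\}$. Addition uses $(+\infty)+(-\infty)=+\infty$ in $\mathtt{CxBiFn}$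 and $=-\infty$ in $\mathtt{CvBiFn}$. Both are symmetric strict monoidal with $\mathbb R^m\otimes\mathbb R^n=\mathbb R^{m+n}$, unit $I=\mathbb R^0=\{\mathbf 0\}$ and $(F\otimes G)((x_1,x_2),(y_1,y_2))=F(x_1,y_1)+G(x_2,y_2)$. Adjoints: for convex $F$ from $\mathbb R^m$ to $\mathbb R^n$, $F^*$ is the concave bifunction from $\mathbb R^n$ to $\mathbb R^m$ with $F^*(y^*,x^* )=\inf_{x,y}\{F(x,y)+\langle x^*,x\rangle-\langle y^*,y\rangle\}$; for concave $G$ from $\mathbb R^n$ to $\mathbb R^m$, $G^*$ is the convex bifunction from $\mathbb R^m$ to $\mathbb R^n$ with $G^*(x^*,y^* )=\sup_{y,x}\{G(y,x)+\langle y^*,y\rangle-\langle x^*,x\rangle\}$. A copy-delete category is a symmetric monoidal category in which every object $X$ carries a commutative comonoid structure $\mathrm{copy}_X:X\to X\otimes X$, $\mathrm{discard}_X:X\to I$ (compatible with the tensor). A functor of copy-delete categories is a symmetric monoidal functor (here strict and identity on objects) preserving copy and discard. $\mathtt{Vect}$ is the category of the spaces $\mathbb R^n$ and linear maps, with tensor $\oplus$, and copy-delete structure given by $\Delta:\mathbb R^n\to\mathbb R^n\oplus\mathbb R^n$, $x\mapsto(x,x)$, and $!:\mathbb R^n\to\mathbb R^0$. $(\mathtt{CxBiFn},\bullet)$ has $\mathrm{copy}(x,(y,z))=\{|x=y=z|\}$ and $\mathrm{discard}(x,\mathbf 0)=0$. $(\mathtt{CvBiFn}^{\mathrm{op}},\circ)$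 has as copy on $\mathbb R^n$ the concave bifunction $\mathbb R^n\otimes\mathbb R^n\to\mathbb R^n$, $((x,y),z)\mapsto-\{|x+y=z|\}$, and as discard the concave bifunction $I\to\mathbb R^n$, $(\mathbf 0,x)\mapsto-\{|x=0|\}$ (both regarded as morphisms of the opposite category). *)

(* Defs.v *)
From HB Require Import structures.
From mathcomp Require Import all_boot all_order all_algebra.
From mathcomp Require Import all_classical all_reals.
From mathcomp Require Import interval_inference ereal convex ring lra.

Set Implicit Arguments.
Unset Strict Implicit.
Unset Printing Implicit Defensive.

Import Order.TTheory GRing.Theory Num.Theory.
Local Open Scope classical_set_scope.
Local Open Scope ring_scope.

(* Strict symmetric monoidal categories. The monoid laws on objects are
   propositional equations, so the laws on morphisms are stated up to the
   identity morphisms [idto e : X -> Y] induced by equations [e : X = Y];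
   since these are the only coherence morphisms, the pentagon and triangle
   identities hold automatically. Composition is in the order g \oc f = g after f. *)

Definition idto_of (obj : Type) (hom : obj -> obj -> Type)
    (idm : forall X, hom X X) (X Y : obj) (e : X = Y) : hom X Y :=
  match e in _ = Z return hom X Z with erefl => idm X end.

Record smcat := SMCat {
  obj :> Type;
  hom : obj -> obj -> Type;
  idm : forall X, hom X X;
  compm : forall X Y Z, hom Y Z -> hom X Y -> hom X Z;
  tens : obj -> obj -> obj;
  unit_obj : obj;
  tensm : forall X X' Y Y',
    hom X X' -> hom Y Y' -> hom (tens X Y) (tens X' Y');
  symm : forall X Y, hom (tens X Y) (tens Y X);
  tensA : forall X Y Z, tens X (tens Y Z) = tens (tens X Y) Z;
  tens1 : forall X, tens unit_obj X = X;
  tens1r : forall X, tens X unit_obj = X;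
  _ : forall X Y Z T (h : hom Z T) (g : hom Y Z) (f : hom X Y),
    compm h (compm g f) = compm (compm h g) f;
  _ : forall X Y (f : hom X Y), compm (idm Y) f = f;
  _ : forall X Y (f : hom X Y), compm f (idm X) = f;
  _ : forall X Y, tensm (idm X) (idm Y) = idm (tens X Y);
  _ : forall X X' X'' Y Y' Y'' (f' : hom X' X'') (f : hom X X')
      (g' : hom Y' Y'') (g : hom Y Y'),
    tensm (compm f' f) (compm g' g) = compm (tensm f' g') (tensm f g);
  _ : forall X X' Y Y' Z Z' (f : hom X X') (g : hom Y Y') (h : hom Z Z'),
    compm (idto_of idm (tensA X' Y' Z')) (tensm f (tensm g h)) =
    compm (tensm (tensm f g) h) (idto_of idm (tensA X Y Z));
  _ : forall X Y (f : hom X Y),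
    compm (idto_of idm (tens1 Y)) (tensm (idm unit_obj) f) =
    compm f (idto_of idm (tens1 X));
  _ : forall X Y (f : hom X Y),
    compm (idto_of idm (tens1r Y)) (tensm f (idm unit_obj)) =
    compm f (idto_of idm (tens1r X));
  _ : forall X X' Y Y' (f : hom X X') (g : hom Y Y'),
    compm (symm X' Y') (tensm f g) = compm (tensm g f) (symm X Y);
  _ : forall X Y, compm (symm Y X) (symm X Y) = idm (tens X Y);
  _ : forall X Y Z,
    symm X (tens Y Z) =
    compm (idto_of idm (tensA Y Z X))
     (compm (tensm (idm Y) (symm X Z))
      (compm (idto_of idm (esym (tensA Y X Z)))
       (compm (tensm (symm X Y) (idm Z)) (idto_of idm (tensA X Y Z)))))
}.

Arguments hom {s} X Y.
Arguments idm {s} X.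
Arguments compm {s X Y Z} g f.
Arguments tens {s} X Y.
Arguments unit_obj {s}.
Arguments tensm {s X X' Y Y'} f g.
Arguments symm {s} X Y.
Arguments tensA {s} X Y Z.
Arguments tens1 {s} X.
Arguments tens1r {s} X.

Declare Scope smcat_scope.
Delimit Scope smcat_scope with smcat.
Notation "X \ox Y" := (tens X Y) (at level 40, left associativity) : smcat_scope.
Notation "f \om g" := (tensm f g) (at level 40, left associativity) : smcat_scope.
Notation "g \oc f" := (compm g f) (at level 50, left associativity) : smcat_scope.

Definition idto (C : smcat) (X Y : C) (e : X = Y) : hom X Y := idto_of idm e.

Section Opposite.
Local Open Scope smcat_scope.
Variable C : smcat.

Lemma smcompA (X Y Z T : C) (h : hom Z T) (g : hom Y Z) (f : hom X Y) :
  h \oc (g \oc f) = h \oc g \oc f.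
Proof. by move: X Y Z T h g f; case: C. Qed.

Lemma smcomp1 (X Y : C) (f : hom X Y) : idm Y \oc f = f.
Proof. by move: X Y f; case: C. Qed.

Lemma smcomp1r (X Y : C) (f : hom X Y) : f \oc idm X = f.
Proof. by move: X Y f; case: C. Qed.

Lemma smtensm1 (X Y : C) : idm X \om idm Y = idm (X \ox Y).
Proof. by move: X Y; case: C. Qed.

Lemma smtensm_comp (X X' X'' Y Y' Y'' : C) (f' : hom X' X'') (f : hom X X')
    (g' : hom Y' Y'') (g : hom Y Y') :
  (f' \oc f) \om (g' \oc g) = (f' \om g') \oc (f \om g).
Proof. by move: X X' X'' Y Y' Y'' f' f g' g; case: C. Qed.

Lemma smtensmA (X X' Y Y' Z Z' : C) (f : hom X X') (g : hom Y Y')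
    (h : hom Z Z') :
  idto (tensA X' Y' Z') \oc (f \om (g \om h)) =
  (f \om g \om h) \oc idto (tensA X Y Z).
Proof. by rewrite /idto; move: X X' Y Y' Z Z' f g h; case: C. Qed.

Lemma smtensm1l (X Y : C) (f : hom X Y) :
  idto (tens1 Y) \oc (idm unit_obj \om f) = f \oc idto (tens1 X).
Proof. by rewrite /idto; move: X Y f; case: C. Qed.

Lemma smtensm1r (X Y : C) (f : hom X Y) :
  idto (tens1r Y) \oc (f \om idm unit_obj) = f \oc idto (tens1r X).
Proof. by rewrite /idto; move: X Y f; case: C. Qed.

Lemma smsymm_nat (X X' Y Y' : C) (f : hom X X') (g : hom Y Y') :
  symm X' Y' \oc (f \om g) = (g \om f) \oc symm X Y.
Proof. by move: X X' Y Y' f g; case: C. Qed.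

Lemma smsymmK (X Y : C) : symm Y X \oc symm X Y = idm (X \ox Y).
Proof. by move: X Y; case: C. Qed.

Lemma smhexagon (X Y Z : C) :
  symm X (Y \ox Z) =
  idto (tensA Y Z X) \oc ((idm Y \om symm X Z) \oc
    (idto (esym (tensA Y X Z)) \oc
      ((symm X Y \om idm Z) \oc idto (tensA X Y Z)))).
Proof. by rewrite /idto; move: X Y Z; case: C. Qed.

Lemma idtoK (X Y : C) (e : X = Y) : idto (esym e) \oc idto e = idm X.
Proof. by case: Y / e; rewrite smcomp1. Qed.

Lemma idtoVK (X Y : C) (e : X = Y) : idto e \oc idto (esym e) = idm Y.
Proof. by case: Y / e; rewrite smcomp1. Qed.

Lemma idto_of_op (X Y : C) (e : X = Y) :
  idto_of (hom := fun X Y : C => hom Y X) idm e = idto (esym e).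
Proof. by case: Y / e. Qed.

Lemma turn_square (X Y X' Y' : C) (i : hom X X') (i' : hom X' X)
    (j : hom Y Y') (j' : hom Y' Y) (f : hom X Y) (f' : hom X' Y') :
  i \oc i' = idm X' -> j' \oc j = idm Y ->
  j \oc f = f' \oc i -> f \oc i' = j' \oc f'.
Proof.
move=> ii' j'j sq; rewrite -[f]smcomp1 -j'j -[j' \oc j \oc f]smcompA sq.
by rewrite -!smcompA ii' smcomp1r.
Qed.

Definition opcat : smcat.
refine (@SMCat C (fun X Y => hom Y X) idm (fun X Y Z g f => f \oc g)
  tens unit_obj (fun X X' Y Y' f g => f \om g) (fun X Y => symm Y X)
  tensA tens1 tens1r _ _ _ _ _ _ _ _ _ _ _).
- by move=> *; rewrite smcompA.
- by move=> *; rewrite smcomp1r.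
- by move=> *; rewrite smcomp1.
- by move=> *; rewrite smtensm1.
- by move=> *; rewrite smtensm_comp.
- move=> X X' Y Y' Z Z' f g h; rewrite !idto_of_op.
  exact: turn_square (idtoVK _) (idtoK _) (smtensmA _ _ _).
- move=> X Y f; rewrite !idto_of_op.
  exact: turn_square (idtoVK _) (idtoK _) (smtensm1l _).
- move=> X Y f; rewrite !idto_of_op.
  exact: turn_square (idtoVK _) (idtoK _) (smtensm1r _).
- by move=> *; rewrite smsymm_nat.
- by move=> *; rewrite smsymmK.
- move=> X Y Z; rewrite !idto_of_op.
  have cancelr (T S : C) (u v : hom T S) (w : hom S T) :
      w \oc u = idm T -> u \oc w = idm S -> w \oc v = idm T -> u = v.
    by move=> wu uw wv; rewrite -[v]smcomp1 -uw -smcompA wv smcomp1r.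
  apply: (cancelr _ _ _ _ (symm X (Y \ox Z))); rewrite ?smsymmK//.
  rewrite smhexagon -!smcompA.
  have -> : esym (esym (tensA Y X Z)) = tensA Y X Z by [].
  have step (T S U : C) (u : hom S T) (v : hom T S) (w : hom U T) :
      u \oc v = idm T -> u \oc (v \oc w) = w.
    by move=> uv; rewrite smcompA uv smcomp1.
  rewrite (step _ _ _ _ _ _ (idtoVK _)).
  rewrite (step _ _ _ (symm X Y \om idm Z) _ _); last first.
    by rewrite -smtensm_comp smsymmK smcomp1 smtensm1.
  rewrite (step _ _ _ _ _ _ (idtoK _)).
  rewrite (step _ _ _ (idm Y \om symm X Z) _ _); last first.
    by rewrite -smtensm_comp smsymmK smcomp1 smtensm1.
  exact: idtoVK.
Defined.

End Opposite.

Section CopyDelete.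
Local Open Scope smcat_scope.

Record cdcat := CDCat {
  cd_smcat :> smcat;
  copy : forall X : cd_smcat, hom X (X \ox X);
  discard : forall X : cd_smcat, hom X unit_obj;
  _ : forall X, idto (tensA X X X) \oc ((idm X \om copy X) \oc copy X) =
                (copy X \om idm X) \oc copy X;
  _ : forall X, idto (tens1 X) \oc ((discard X \om idm X) \oc copy X) = idm X;
  _ : forall X, idto (tens1r X) \oc ((idm X \om discard X) \oc copy X) = idm X;
  _ : forall X, symm X X \oc copy X = copy X;
  (* compatibility with the tensor: the middle-four interchange
     (X \ox X) \ox (Y \ox Y) -> (X \ox Y) \ox (X \ox Y) is spelled out *)
  _ : forall X Y, copy (X \ox Y) =
    idto (tensA X Y (X \ox Y)) \oc
     ((idm X \om (idto (esym (tensA Y X Y)) \oc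
         ((symm X Y \om idm Y) \oc idto (tensA X Y Y)))) \oc
      (idto (esym (tensA X X (Y \ox Y))) \oc (copy X \om copy Y)));
  _ : forall X Y, discard (X \ox Y) =
    idto (tens1 unit_obj) \oc (discard X \om discard Y);
  _ : copy unit_obj = idto (esym (tens1 unit_obj));
  _ : discard unit_obj = idm unit_obj
}.

Record is_cdfunctor (C D : cdcat) (fo : C -> D)
    (fh : forall X Y : C, hom X Y -> hom (fo X) (fo Y)) : Prop := IsCDFunctor {
  fh_id : forall X, fh X X (idm X) = idm (fo X);
  fh_comp : forall X Y Z (g : hom Y Z) (f : hom X Y),
    fh X Z (g \oc f) = fh Y Z g \oc fh X Y f;
  fo_tens : forall X Y, fo (X \ox Y) = fo X \ox fo Y;
  fo_unit : fo unit_obj = unit_obj;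
  fh_tens : forall X X' Y Y' (f : hom X X') (g : hom Y Y'),
    idto (fo_tens X' Y') \oc fh _ _ (f \om g) =
    (fh _ _ f \om fh _ _ g) \oc idto (fo_tens X Y);
  fh_symm : forall X Y,
    idto (fo_tens Y X) \oc fh _ _ (symm X Y) =
    symm (fo X) (fo Y) \oc idto (fo_tens X Y);
  fh_copy : forall X, idto (fo_tens X X) \oc fh _ _ (copy X) = copy (fo X);
  fh_discard : forall X,
    idto fo_unit \oc fh _ _ (discard X) = discard (fo X)
}.

End CopyDelete.

(* R^n is 'cV[R]_n, and R^(m + n) is identified with R^m x R^n through
   [col_mx], [usubmx] and [dsubmx]. *)

Section Coordinates.
Variable R : realType.

Lemma colI m n (P : 'cV[R]_(m + n) -> Prop) :
  (forall a b, P (col_mx a b)) -> forall x, P x.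
Proof. by move=> Pcol x; rewrite -[x]vsubmxK. Qed.

Lemma cV0_eq (x y : 'cV[R]_0) : x = y.
Proof. by apply/matrixP => -[]. Qed.

Definition vcast m n (e : m = n) (x : 'cV[R]_m) : 'cV[R]_n :=
  castmx (e, erefl 1%N) x.

Lemma vcast_id m (e : m = m) x : vcast e x = x.
Proof. by rewrite /vcast castmx_id. Qed.

Lemma vcastA m n p (e : (m + (n + p) = m + n + p)%N) a b c :
  vcast e (col_mx a (col_mx b c)) = col_mx (col_mx a b) c.
Proof.
rewrite /vcast col_mxA (eq_irrelevance e (addnA m n p)).
exact: (castmxKV (addnA m n p) (erefl 1%N)).
Qed.

Lemma vcastAV m n p (e : (m + n + p = m + (n + p))%N) a b c :
  vcast e (col_mx (col_mx a b) c) = col_mx a (col_mx b c).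
Proof.
rewrite -(vcastA (esym e)) /vcast.
exact: (castmxKV e (erefl 1%N)).
Qed.

Lemma vcast0n n (e : (0 + n = n)%N) a (b : 'cV[R]_n) : vcast e (col_mx a b) = b.
Proof. by rewrite vcast_id; exact: col_flat_mx. Qed.

Lemma vcast0nV n (e : (n = 0 + n)%N) a (b : 'cV[R]_n) : vcast e b = col_mx a b.
Proof. by rewrite vcast_id; exact/esym/col_flat_mx. Qed.

Lemma vcastn0 n (e : (n + 0 = n)%N) (a : 'cV[R]_n) b : vcast e (col_mx a b) = a.
Proof.
apply/matrixP => i j; rewrite castmxE/= -(col_mxEu a b).
by congr (col_mx _ _ _ _); apply/val_inj.
Qed.

Lemma vcastn0V n (e : (n = n + 0)%N) (a : 'cV[R]_n) b : vcast e a = col_mx a b.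
Proof.
apply/matrixP => i j; rewrite castmxE/= -(col_mxEu a b).
by congr (col_mx _ _ _ _); apply/val_inj.
Qed.

Lemma vcastK m n (e : m = n) (e' : n = m) x : vcast e' (vcast e x) = x.
Proof. by case: n / e e' x => e' x; rewrite !vcast_id. Qed.

End Coordinates.

Section Vect.
Variable R : realType.
Implicit Types m n : nat.

Definition dsum_fun m m' n n' (f : 'Hom('cV[R]_m, 'cV[R]_m'))
    (g : 'Hom('cV[R]_n, 'cV[R]_n')) (x : 'cV[R]_(m + n)) : 'cV[R]_(m' + n') :=
  col_mx (f (usubmx x)) (g (dsubmx x)).

Fact dsum_fun_linear m m' n n' f g : linear (@dsum_fun m m' n n' f g).
Proof.
by move=> a x y; rewrite /dsum_fun scale_col_mx add_col_mx !linearP.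
Qed.

HB.instance Definition _ m m' n n' f g :=
  GRing.isLinear.Build R _ _ _ (@dsum_fun m m' n n' f g)
    (@dsum_fun_linear m m' n n' f g).

Definition swap_fun m n (x : 'cV[R]_(m + n)) : 'cV[R]_(n + m) :=
  col_mx (dsubmx x) (usubmx x).

Fact swap_fun_linear m n : linear (@swap_fun m n).
Proof.
by move=> a x y; rewrite /swap_fun scale_col_mx add_col_mx !linearP.
Qed.

HB.instance Definition _ m n :=
  GRing.isLinear.Build R _ _ _ (@swap_fun m n) (@swap_fun_linear m n).

Definition diag_fun n (x : 'cV[R]_n) : 'cV[R]_(n + n) := col_mx x x.

Fact diag_fun_linear n : linear (@diag_fun n).
Proof. by move=> a x y; rewrite /diag_fun scale_col_mx add_col_mx. Qed.

HB.instance Definition _ n :=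
  GRing.isLinear.Build R _ _ _ (@diag_fun n) (@diag_fun_linear n).

Definition lin_dsum m m' n n' (f : 'Hom('cV[R]_m, 'cV[R]_m'))
    (g : 'Hom('cV[R]_n, 'cV[R]_n')) : 'Hom('cV[R]_(m + n), 'cV[R]_(m' + n')) :=
  linfun (dsum_fun f g).

Definition lin_swap m n : 'Hom('cV[R]_(m + n), 'cV[R]_(n + m)) :=
  linfun (@swap_fun m n).

Lemma lin_dsumE m m' n n' (f : 'Hom('cV[R]_m, 'cV[R]_m'))
    (g : 'Hom('cV[R]_n, 'cV[R]_n')) a b :
  lin_dsum f g (col_mx a b) = col_mx (f a) (g b).
Proof. by rewrite lfunE/= /dsum_fun col_mxKu col_mxKd. Qed.

Lemma lin_swapE m n (a : 'cV[R]_m) (b : 'cV[R]_n) :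
  lin_swap m n (col_mx a b) = col_mx b a.
Proof. by rewrite lfunE/= /swap_fun col_mxKu col_mxKd. Qed.

Lemma lin_diagE n (x : 'cV[R]_n) : linfun (@diag_fun n) x = col_mx x x.
Proof. by rewrite lfunE. Qed.

Lemma idto_lin m n (e : m = n) x :
  idto_of (hom := fun m n => 'Hom('cV[R]_m, 'cV[R]_n)) (fun m => \1%VF) e x =
  vcast e x.
Proof. by case: n / e; rewrite id_lfunE vcast_id. Qed.

Let linE := (comp_lfunE, id_lfunE, lin_dsumE, lin_swapE, idto_lin, lin_diagE,
  zero_lfunE, vcastA, vcastAV, vcast0n, vcastn0).

Definition Vect : smcat.
refine (@SMCat nat (fun m n => 'Hom('cV[R]_m, 'cV[R]_n)) (fun n => \1%VF)
  (fun m n p g f => (g \o f)%VF) addn 0%N lin_dsum lin_swap addnA add0n addn0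
  _ _ _ _ _ _ _ _ _ _ _).
- by move=> *; rewrite comp_lfunA.
- by move=> *; rewrite comp_lfun1l.
- by move=> *; rewrite comp_lfun1r.
- by move=> m n; apply/lfunP; elim/colI => a b; rewrite !linE.
- by move=> *; apply/lfunP; elim/colI => a b; rewrite !linE.
- move=> *; apply/lfunP; elim/colI => a; elim/colI => b c.
  by rewrite !linE.
- by move=> *; apply/lfunP; elim/colI => a b; rewrite !linE.
- by move=> *; apply/lfunP; elim/colI => a b; rewrite !linE.
- by move=> *; apply/lfunP; elim/colI => a b; rewrite !linE.
- by move=> *; apply/lfunP; elim/colI => a b; rewrite !linE.
- move=> *; apply/lfunP; elim/colI => a; elim/colI => b c.
  by rewrite !linE.
Defined.

Definition Vect_cd : cdcat.
refine (@CDCat Vect (fun n => linfun (@diag_fun n)) (fun n => 0)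
  _ _ _ _ _ _ _ _) => /=.
- by move=> n; apply/lfunP => x; rewrite /idto !linE.
- by move=> n; apply/lfunP => x; rewrite /idto !linE.
- by move=> n; apply/lfunP => x; rewrite /idto !linE.
- by move=> n; apply/lfunP => x; rewrite /idto !linE.
- by move=> m n; apply/lfunP; elim/colI => a b; rewrite /idto !linE.
- by move=> m n; apply/lfunP => x; exact: cV0_eq.
- by apply/lfunP => x; exact: cV0_eq.
- by apply/lfunP => x; exact: cV0_eq.
Defined.

End Vect.

Section Convexity.
Variable R : realType.
Local Open Scope ereal_scope.

Definition epigraph (E : lmodType R) (f : E -> \bar R) : set (E * R^o) :=
  [set p | f p.1 <= p.2%:E].

Definition cvx_fun (E : lmodType R) (f : E -> \bar R) : Prop :=
  @convex_set R (E * R^o)%type (epigraph f).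

Definition ccv_fun (E : lmodType R) (f : E -> \bar R) : Prop :=
  cvx_fun (fun x => - f x).

(* {|P|} *)
Definition ind (P : Prop) : \bar R := if `[< P >] then 0 else +oo.

Lemma cvx_funP (E : lmodType R) (f : E -> \bar R) :
  cvx_fun f <->
  forall (t : R) x y (a b : R), (0 < t)%R -> (t < 1)%R ->
    f x <= a%:E -> f y <= b%:E ->
    f (t *: x + (1 - t) *: y)%R <= (t * a + (1 - t) * b)%:E.
Proof.
rewrite /cvx_fun convex_setW; split => [cf t x y a b t0 t1 fx fy|cf].
  have := cf (x, a) (y, b) _ _ (Itv01 (ltW t0) (ltW t1)) t0 t1.
  by rewrite !inE; exact.
move=> [x a] [y b]; rewrite !inE /epigraph/= => fx fy k k0 k1.
by rewrite inE; exact: (cf k%:num x y a b k0 k1 fx fy).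
Qed.

Lemma lt_fin_mid (x : \bar R) (a : R) : x < a%:E ->
  exists2 r : R, x <= r%:E & (r < a)%R.
Proof.
case: x => [r| |]; rewrite ?lte_fin => ra //; first by exists r.
by exists (a - 1)%R; rewrite ?leNye// ltrBlDr ltrDl.
Qed.

Lemma cvx_funPlt (E : lmodType R) (f : E -> \bar R) :
  cvx_fun f <->
  forall (t : R) x y (a b : R), (0 < t)%R -> (t < 1)%R ->
    f x < a%:E -> f y < b%:E ->
    f (t *: x + (1 - t) *: y)%R <= (t * a + (1 - t) * b)%:E.
Proof.
rewrite cvx_funP; split => [cf t x y a b t0 t1 fx fy|cf t x y a b t0 t1 fx fy].
  by apply: cf => //; exact: ltW.
apply/lee_addgt0Pr => e e0.
have -> : (t * a + (1 - t) * b)%:E + e%:E =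
          (t * (a + e) + (1 - t) * (b + e))%:E.
  by rewrite -EFinD; congr EFin; ring.
by apply: cf => //; [apply: le_lt_trans fx _|apply: le_lt_trans fy _];
  rewrite lte_fin ltrDl.
Qed.

Lemma dadde_lt (x y : \bar R) (a : R) : (x + y)%dE < a%:E ->
  exists b c : R, [/\ x <= b%:E, y <= c%:E & (b + c <= a)%R].
Proof.
case: x => [x| |]; case: y => [y| |] //=; rewrite ?ltNyr ?lte_fin => xya.
- by exists x, y; split => //; exact: ltW.
- by exists x, (a - x)%R; rewrite leNye subrKC.
- by exists (a - y)%R, y; rewrite leNye subrK.
- by exists a, 0%R; rewrite !leNye addr0.
Qed.

Lemma dadde_le (x y : \bar R) (b c : R) : x <= b%:E -> y <= c%:E ->
  (x + y)%dE <= (b + c)%:E.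
Proof.
case: x => [x| |]; case: y => [y| |] //= xb yc; rewrite ?leNye//.
by rewrite lee_fin lerD.
Qed.

Lemma cvx_funD (E : lmodType R) (f g : E -> \bar R) :
  cvx_fun f -> cvx_fun g -> cvx_fun (fun x => (f x + g x)%dE : \bar R).
Proof.
move=> /cvx_funP cf /cvx_funP cg; apply/cvx_funPlt => t x y a b t0 t1.
move=> /dadde_lt[a1 [a2 [fa ga aa]]] /dadde_lt[b1 [b2 [fb gb bb]]].
have := dadde_le (cf t x y _ _ t0 t1 fa fb) (cg t x y _ _ t0 t1 ga gb).
move=> /le_trans; apply; rewrite lee_fin.
have h1 : (t * (a1 + a2) <= t * a)%R by rewrite ler_pM2l.
have h2 : ((1 - t) * (b1 + b2) <= (1 - t) * b)%R by rewrite ler_pM2l// subr_gt0.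
by lra.
Qed.

Lemma cvx_fun_comp (E E' : lmodType R) (f : E -> \bar R) (h : E' -> E) :
  (forall a x y, h (a *: x + (1 - a) *: y) = a *: h x + (1 - a) *: h y)%R ->
  cvx_fun f -> cvx_fun (fun x => f (h x)).
Proof.
move=> hl /cvx_funP cf; apply/cvx_funP => t x y a b t0 t1 fx fy.
by rewrite hl; exact: cf.
Qed.

Lemma cvx_fun_inf (E Y : lmodType R) (f : E * Y -> \bar R) :
  cvx_fun f -> cvx_fun (fun x => ereal_inf [set f (x, y) | y in setT]).
Proof.
move=> /cvx_funP cf; apply/cvx_funPlt => t x y a b t0 t1.
move=> /ereal_inf_lt[_ [u _ <-] fa] /ereal_inf_lt[_ [v _ <-] fb].
apply: ge_ereal_inf; exists (f (t *: (x, u) + (1 - t) *: (y, v)))%R.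
  by exists (t *: u + (1 - t) *: v)%R.
by apply: cf => //; exact: ltW.
Qed.

Lemma indT (P : Prop) : P -> ind P = 0.
Proof. by move=> p; rewrite /ind asboolT. Qed.

Lemma indF (P : Prop) : ~ P -> ind P = +oo.
Proof. by move=> p; rewrite /ind asboolF. Qed.

Lemma ind_le (P : Prop) (a : R) : ind P <= a%:E -> P /\ (0 <= a)%R.
Proof. by rewrite /ind; case: asboolP => // p; rewrite lee_fin. Qed.

Lemma cvx_ind (E : lmodType R) (P : E -> Prop) :
  (forall (a : R) x y, P x -> P y -> P (a *: x + (1 - a) *: y)%R) ->
  cvx_fun (fun x => ind (P x)).
Proof.
move=> cP; apply/cvx_funP => t x y a b t0 t1 /ind_le[px a0] /ind_le[py b0].
rewrite indT ?lee_fin; last exact: cP.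
by rewrite addr_ge0// mulr_ge0// ltW// subr_gt0.
Qed.

Lemma dadd0E (x : \bar R) : (0%E + x)%dE = x.
Proof. exact: (@add0r (\bar^d R)). Qed.

Lemma ind_add (P Q : Prop) : (ind P + ind Q)%dE = ind (P /\ Q).
Proof.
case: (pselect P) => p; last first.
  by rewrite (indF p) (@indF (_ /\ _)) => [|[]]; first by case: (ind Q).
rewrite (indT p) dadd0E; congr (if _ then _ else _).
by apply: asbool_equiv_eq; split => [//|[]].
Qed.

End Convexity.

(* Convex bifunctions are added with +%dE, for which +oo + -oo = +oo, and concave
   ones with +%E, for which +oo + -oo = -oo. *)

Section ConvexBifunctions.
Variable R : realType.
Implicit Types m n : nat.
Local Open Scope ereal_scope.

Record cxbifn m n := CxBifn {
  cxbifn_fun :> 'cV[R]_m -> 'cV[R]_n -> \bar R;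
  cxbifn_cvx : @cvx_fun R ('cV[R]_m * 'cV[R]_n)%type
                 (fun p => cxbifn_fun p.1 p.2)
}.

Lemma cxbifnP m n (F G : cxbifn m n) : (forall x y, F x y = G x y) -> F = G.
Proof.
case: F G => [F cF] [G cG]/= FG.
have {}FG : F = G by apply/funext => x; apply/funext => y.
by case: G / FG cG => cG; congr CxBifn; exact: Prop_irrelevance.
Qed.

Fact cxid_cvx n :
  @cvx_fun R ('cV[R]_n * 'cV[R]_n)%type (fun p => ind R (p.1 = p.2)).
Proof.
by apply: (@cvx_ind R ('cV[R]_n * 'cV[R]_n)%type) => a x y /= -> ->.
Qed.

Definition cxid n : cxbifn n n :=
  @CxBifn n n (fun x y => ind R (x = y)) (@cxid_cvx n).

Fact cxcomp_cvx m n p (F : cxbifn n p) (G : cxbifn m n) :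
  @cvx_fun R ('cV[R]_m * 'cV[R]_p)%type (fun q =>
    ereal_inf [set (G q.1 y + F y q.2)%dE | y in [set: 'cV[R]_n]]).
Proof.
apply: (@cvx_fun_inf R ('cV[R]_m * 'cV[R]_p)%type 'cV[R]_n
  (fun q => (G q.1.1 q.2 + F q.2 q.1.2)%dE : \bar R)).
apply: cvx_funD.
- exact: (@cvx_fun_comp R ('cV[R]_m * 'cV[R]_n)%type
    ('cV[R]_m * 'cV[R]_p * 'cV[R]_n)%type _ (fun q => (q.1.1, q.2))
    _ (@cxbifn_cvx _ _ G)).
- exact: (@cvx_fun_comp R ('cV[R]_n * 'cV[R]_p)%type
    ('cV[R]_m * 'cV[R]_p * 'cV[R]_n)%type _ (fun q => (q.2, q.1.2))
    _ (@cxbifn_cvx _ _ F)).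
Qed.

Definition cxcomp m n p (F : cxbifn n p) (G : cxbifn m n) : cxbifn m p :=
  CxBifn (cxbifn_fun := fun x z =>
    ereal_inf [set (G x y + F y z)%dE | y in [set: 'cV[R]_n]])
    (@cxcomp_cvx _ _ _ F G).

Fact cxtens_cvx m m' n n' (F : cxbifn m m') (G : cxbifn n n') :
  @cvx_fun R ('cV[R]_(m + n) * 'cV[R]_(m' + n'))%type (fun q =>
    (F (usubmx q.1) (usubmx q.2) + G (dsubmx q.1) (dsubmx q.2))%dE).
Proof.
apply: cvx_funD.
- apply: (@cvx_fun_comp R ('cV[R]_m * 'cV[R]_m')%type
    ('cV[R]_(m + n) * 'cV[R]_(m' + n'))%type _
    (fun q => (usubmx q.1, usubmx q.2)) _ (@cxbifn_cvx _ _ F)).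
  by move=> a x y /=; rewrite !linearD !linearZ.
- apply: (@cvx_fun_comp R ('cV[R]_n * 'cV[R]_n')%type
    ('cV[R]_(m + n) * 'cV[R]_(m' + n'))%type _
    (fun q => (dsubmx q.1, dsubmx q.2)) _ (@cxbifn_cvx _ _ G)).
  by move=> a x y /=; rewrite !linearD !linearZ.
Qed.

Definition cxtens m m' n n' (F : cxbifn m m') (G : cxbifn n n') :
    cxbifn (m + n) (m' + n') :=
  CxBifn (cxbifn_fun := fun x y =>
    (F (usubmx x) (usubmx y) + G (dsubmx x) (dsubmx y))%dE)
    (@cxtens_cvx _ _ _ _ F G).

Fact cxsymm_cvx m n :
  @cvx_fun R ('cV[R]_(m + n) * 'cV[R]_(n + m))%type (fun q =>
    ind R (usubmx q.1 = dsubmx q.2 /\ dsubmx q.1 = usubmx q.2)).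
Proof.
apply: (@cvx_ind R ('cV[R]_(m + n) * 'cV[R]_(n + m))%type) => a x y /=.
by rewrite !linearD !linearZ/= => -[-> ->] [-> ->].
Qed.

Definition cxsymm m n : cxbifn (m + n) (n + m) :=
  CxBifn (cxbifn_fun := fun x y =>
    ind R (usubmx x = dsubmx y /\ dsubmx x = usubmx y)) (@cxsymm_cvx m n).

Fact cxcopy_cvx n :
  @cvx_fun R ('cV[R]_n * 'cV[R]_(n + n))%type (fun q =>
    ind R (q.1 = usubmx q.2 /\ usubmx q.2 = dsubmx q.2)).
Proof.
apply: (@cvx_ind R ('cV[R]_n * 'cV[R]_(n + n))%type) => a x y /=.
by rewrite !linearD !linearZ/= => -[-> ->] [-> ->].
Qed.

Definition cxcopy n : cxbifn n (n + n) :=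
  CxBifn (cxbifn_fun := fun x p =>
    ind R (x = usubmx p /\ usubmx p = dsubmx p)) (@cxcopy_cvx n).

Fact cxdiscard_cvx n :
  @cvx_fun R ('cV[R]_n * 'cV[R]_0)%type (fun=> 0).
Proof.
apply/cvx_funP => t x y a b t0 t1; rewrite !lee_fin => a0 b0.
by rewrite addr_ge0// mulr_ge0// ltW// subr_gt0.
Qed.

Definition cxdiscard n : cxbifn n 0 :=
  CxBifn (cxbifn_fun := fun _ _ => 0) (@cxdiscard_cvx n).

Lemma eq_ereal_lb (x y : \bar R) : (forall c, (c <= x) = (c <= y)) -> x = y.
Proof. by move=> xy; apply/le_anti; rewrite -xy lexx/= xy lexx. Qed.

Lemma le_infP (T : Type) (f : T -> \bar R) c :
  (c <= ereal_inf [set f y | y in setT]) <-> (forall y, c <= f y).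
Proof.
split=> [/ereal_infP h y|h]; first by apply: h; exists y.
by apply/ereal_infP => _ [y _ <-].
Qed.

Lemma eq_inf_lb (T T' : Type) (f : T -> \bar R) (g : T' -> \bar R) :
  (forall c, (forall y, c <= f y) <-> (forall y, c <= g y)) ->
  ereal_inf [set f y | y in setT] = ereal_inf [set g y | y in setT].
Proof.
move=> fg; apply: eq_ereal_lb => c; apply/idP/idP.
  by move=> /le_infP/fg/le_infP.
by move=> /le_infP/fg/le_infP.
Qed.

Lemma dadd_infr (T : Type) (f : T -> \bar R) (x : \bar R) :
  (x + ereal_inf [set f y | y in setT])%dE =
  ereal_inf [set (x + f y)%dE | y in setT].
Proof.
case: x => [r| |].
- apply: eq_ereal_lb => c.
  have adj s : (c <= (r%:E + s)%dE) = (((- r)%:E + c)%dE <= s :> \bar R).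
    case: c s => [c| |] [s| |] //=; rewrite ?leNye ?leey ?lee_fin//; last first.
    by rewrite -[in RHS](lerD2l r) addNKr.
  rewrite adj; apply/idP/idP.
    by move=> /le_infP h; apply/le_infP => y; rewrite adj.
  by move=> /le_infP h; apply/le_infP => y; rewrite -adj.
- apply/esym/le_anti; rewrite leey/=; apply/le_infP => y.
  by case: (f y).
- case: (eqVneq (ereal_inf [set f y | y in setT]) +oo) => [E|nE].
    rewrite E; apply/esym/le_anti; rewrite leey/=; apply/le_infP => y.
    suff -> : f y = +oo by [].
    by apply/eqP; rewrite -leye_eq -E; apply: ereal_inf_lbound; exists y.
  have -> : (-oo + ereal_inf [set f y | y in setT])%dE = -oo.
    by move: nE; case: ereal_inf.
  apply/esym/le_anti; rewrite leNye andbT.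
  have : ereal_inf [set f y | y in setT] < +oo by rewrite ltey.
  move=> /ereal_inf_lt[_ [y _ <-] fy].
  apply: ge_ereal_inf; exists (-oo + f y)%dE; first by exists y.
  by move: fy; case: (f y).
Qed.

Lemma daddC (x y : \bar R) : (x + y)%dE = (y + x)%dE :> \bar R.
Proof. exact: (@addrC (\bar^d R)). Qed.

Lemma daddA (x y z : \bar R) :
  (x + (y + z)%dE)%dE = ((x + y)%dE + z)%dE :> \bar R.
Proof. exact: (@addrA (\bar^d R)). Qed.

Lemma daddACA (x y z t : \bar R) :
  ((x + y)%dE + (z + t)%dE)%dE = ((x + z)%dE + (y + t)%dE)%dE :> \bar R.
Proof. exact: (@addrACA (\bar^d R)). Qed.

Lemma dadd_infl (T : Type) (f : T -> \bar R) (x : \bar R) :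
  (ereal_inf [set f y | y in setT] + x)%dE =
  ereal_inf [set (f y + x)%dE | y in setT].
Proof.
rewrite daddC dadd_infr; congr ereal_inf.
by apply/seteqP; split => _ [y _ <-]; exists y => //; rewrite daddC.
Qed.

Lemma cxcompA m n p q (H : cxbifn p q) (G : cxbifn n p) (F : cxbifn m n) :
  cxcomp H (cxcomp G F) = cxcomp (cxcomp H G) F.
Proof.
apply: cxbifnP => x t /=; apply: eq_inf_lb => c.
split=> [h y|h z].
  rewrite dadd_infr; apply/le_infP => z; rewrite daddA.
  by have := h z; rewrite dadd_infl => /le_infP.
rewrite dadd_infl; apply/le_infP => y; rewrite -daddA.
by have := h y; rewrite dadd_infr => /le_infP.
Qed.

Definition is_gr m n (F : 'cV[R]_m -> 'cV[R]_n -> \bar R)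
    (f : 'cV[R]_m -> 'cV[R]_n) :=
  forall x y, F x y = ind R (y = f x).

Lemma daddy (x : \bar R) : (+oo + x)%dE = +oo :> \bar R.
Proof. by case: x. Qed.

Lemma cxcomp_grr m n p (F : cxbifn n p) (G : cxbifn m n) g x z :
  is_gr G g -> cxcomp F G x z = F (g x) z.
Proof.
move=> Gg /=; apply/le_anti/andP; split.
  apply: ge_ereal_inf; exists (G x (g x) + F (g x) z)%dE; first by exists (g x).
  by rewrite Gg indT// dadd0E.
apply/le_infP => y; rewrite Gg.
have [->|yg] := pselect (y = g x); first by rewrite indT// dadd0E.
by rewrite indF// daddy leey.
Qed.

Lemma cxcomp_grl m n p (F : cxbifn n p) (G : cxbifn m n) f f' x z :
  is_gr F f -> cancel f f' -> cancel f' f ->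
  cxcomp F G x z = G x (f' z).
Proof.
move=> Ff fK f'K /=; apply/le_anti/andP; split.
  apply: ge_ereal_inf; exists (G x (f' z) + F (f' z) z)%dE.
    by exists (f' z).
  by rewrite Ff indT ?f'K// daddC dadd0E.
apply/le_infP => y; rewrite Ff daddC.
have [->|yg] := pselect (z = f y); first by rewrite fK indT// dadd0E.
by rewrite indF// daddy leey.
Qed.

Lemma is_gr_id n : is_gr (cxid n) id.
Proof. by move=> x y /=; congr ind; apply/propext; split=> ->. Qed.

Lemma is_gr_comp m n p (F : cxbifn n p) (G : cxbifn m n) f g :
  is_gr F f -> is_gr G g -> is_gr (cxcomp F G) (f \o g).
Proof. by move=> Ff Gg x y; rewrite (cxcomp_grr _ _ _ Gg) Ff. Qed.

Definition fsum m m' n n' (f : 'cV[R]_m -> 'cV[R]_m')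
    (g : 'cV[R]_n -> 'cV[R]_n') (x : 'cV[R]_(m + n)) : 'cV[R]_(m' + n') :=
  col_mx (f (usubmx x)) (g (dsubmx x)).

Lemma is_gr_tens m m' n n' (F : cxbifn m m') (G : cxbifn n n') f g :
  is_gr F f -> is_gr G g -> is_gr (cxtens F G) (fsum f g).
Proof.
move=> Ff Gg x y /=; rewrite Ff Gg ind_add; congr ind; apply/propext.
rewrite -[in y = _](vsubmxK y) /fsum; split=> [[-> ->]//|].
exact: eq_col_mx.
Qed.

Lemma is_gr_symm m n : is_gr (cxsymm m n) (fun x => col_mx (dsubmx x) (usubmx x)).
Proof.
move=> x y /=; congr ind; apply/propext.
rewrite -[in y = _](vsubmxK y); split=> [[-> ->]//|].
by move=> /eq_col_mx[-> ->].
Qed.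

Lemma is_gr_idto m n (e : m = n) :
  is_gr (idto_of (hom := cxbifn) cxid e : cxbifn m n) (vcast e).
Proof.
case: n / e => x y; rewrite vcast_id /=.
exact: is_gr_id.
Qed.

Lemma is_gr_copy n : is_gr (cxcopy n) (fun x => col_mx x x).
Proof.
move=> x y /=; congr ind; apply/propext.
rewrite -[in y = _](vsubmxK y); split=> [[-> <-]//|].
by move=> /eq_col_mx[-> ->].
Qed.

Lemma is_gr_discard n : is_gr (cxdiscard n) (fun=> 0%R).
Proof. by move=> x y /=; rewrite indT//; exact: cV0_eq. Qed.

Lemma is_gr_eq m n (F G : cxbifn m n) f g :
  is_gr F f -> is_gr G g -> f =1 g -> F = G.
Proof. by move=> Ff Gg fg; apply: cxbifnP => x y; rewrite Ff Gg fg. Qed.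

Lemma fsumE m m' n n' (f : 'cV[R]_m -> 'cV[R]_m')
    (g : 'cV[R]_n -> 'cV[R]_n') a b :
  fsum f g (col_mx a b) = col_mx (f a) (g b).
Proof. by rewrite /fsum col_mxKu col_mxKd. Qed.

Lemma swapK m n :
  cancel (fun x : 'cV[R]_(m + n) => col_mx (dsubmx x) (usubmx x))
         (fun x : 'cV[R]_(n + m) => col_mx (dsubmx x) (usubmx x)).
Proof. by move=> x; rewrite col_mxKu col_mxKd vsubmxK. Qed.

End ConvexBifunctions.

Ltac solve_gr :=
  repeat first [ apply: is_gr_comp | apply: is_gr_tens | exact: is_gr_id
               | exact: is_gr_symm | exact: is_gr_idto | exact: is_gr_copy
               | exact: is_gr_discard ].

Section CxBiFn.
Variable R : realType.
Local Open Scope ereal_scope.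

Let grE := (@col_mxKu R, @col_mxKd R, vcastA, vcastAV, vcast0n, vcastn0,
  @fsumE R, vcast_id).

Definition CxBiFn : smcat.
refine (@SMCat nat (@cxbifn R) (@cxid R) (@cxcomp R)
  addn 0%N (@cxtens R) (@cxsymm R) addnA add0n addn0
  _ _ _ _ _ _ _ _ _ _ _).
- by move=> *; exact: cxcompA.
- move=> m n F; apply: cxbifnP => x y.
  by rewrite (@cxcomp_grl R _ _ _ _ _ (id) (id))//; exact: is_gr_id.
- move=> m n F; apply: cxbifnP => x y.
  by rewrite (@cxcomp_grr R _ _ _ _ _ (id))//; exact: is_gr_id.
- move=> m n; apply: is_gr_eq; [by solve_gr..|].
  by elim/colI => a b; rewrite !grE.
- move=> m m' m'' n n' n'' F' F G' G; apply: cxbifnP => x z /=.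
  rewrite dadd_infl; apply: eq_ereal_lb => c; apply/idP/idP.
    move=> /le_infP h; apply/le_infP; elim/colI => y1 y2.
    have := h y1; rewrite dadd_infr => /le_infP/(_ y2).
    by rewrite !grE daddACA.
  move=> /le_infP h; apply/le_infP => y1; rewrite dadd_infr.
  apply/le_infP => y2; rewrite daddACA.
  by have := h (col_mx y1 y2); rewrite !grE.
- move=> m m' n n' p p' F G H; apply: cxbifnP.
  elim/colI => a; elim/colI => b c; elim/colI; elim/colI => a' b' c'.
  rewrite (@cxcomp_grl R _ _ _ _ _ (vcast (addnA m' n' p'))
    (vcast (esym (addnA m' n' p')))); first last.
  + by move=> z; rewrite vcastK.
  + by move=> z; rewrite vcastK.
  + by solve_gr.
  rewrite (@cxcomp_grr R _ _ _ _ _ (vcast (addnA m n p))); last by solve_gr.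
  by rewrite /= !grE daddA.
- move=> m n F; apply: cxbifnP; elim/colI => a b y.
  rewrite (@cxcomp_grl R _ _ _ _ _ (vcast (add0n n))
    (vcast (esym (add0n n)))); first last.
  + by move=> z; rewrite vcastK.
  + by move=> z; rewrite vcastK.
  + by solve_gr.
  rewrite (@cxcomp_grr R _ _ _ _ _ (vcast (add0n m))); last by solve_gr.
  rewrite (vcast0nV _ 0%R)/= !grE indT ?dadd0E//.
  exact: cV0_eq.
- move=> m n F; apply: cxbifnP; elim/colI => a b y.
  rewrite (@cxcomp_grl R _ _ _ _ _ (vcast (addn0 n))
    (vcast (esym (addn0 n)))); first last.
  + by move=> z; rewrite vcastK.
  + by move=> z; rewrite vcastK.
  + by solve_gr.
  rewrite (@cxcomp_grr R _ _ _ _ _ (vcast (addn0 m))); last by solve_gr.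
  rewrite (vcastn0V _ _ 0%R)/= !grE indT ?(daddC _ 0) ?dadd0E//.
  exact: cV0_eq.
- move=> m m' n n' F G; apply: cxbifnP.
  elim/colI => a b; elim/colI => a' b'.
  rewrite (cxcomp_grl _ _ _ (@is_gr_symm R _ _) (@swapK R _ _) (@swapK R _ _)).
  rewrite (cxcomp_grr _ _ _ (@is_gr_symm R _ _)).
  by rewrite /= !grE daddC.
- move=> m n; apply: is_gr_eq; [by solve_gr..|].
  by elim/colI => a b /=; do 4 rewrite ?grE /=.
- move=> m n p; apply: is_gr_eq; [by solve_gr..|].
  by elim/colI => a; elim/colI => b c /=; rewrite !grE.
Defined.

Definition CxBiFn_cd : cdcat.
refine (@CDCat CxBiFn (@cxcopy R) (@cxdiscard R) _ _ _ _ _ _ _ _);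
  rewrite /idto /=.
- move=> n; apply: is_gr_eq; [by solve_gr..|].
  by move=> x /=; rewrite !grE.
- move=> n; apply: is_gr_eq; [by solve_gr..|].
  by move=> x /=; rewrite !grE.
- move=> n; apply: is_gr_eq; [by solve_gr..|].
  by move=> x /=; rewrite !grE.
- move=> n; apply: is_gr_eq; [by solve_gr..|].
  by move=> x /=; rewrite !grE.
- move=> m n; apply: is_gr_eq; [by solve_gr..|].
  by elim/colI => a b /=; do 4 rewrite ?grE /=.
- move=> m n; apply: is_gr_eq; [by solve_gr..|].
  by move=> x; exact: cV0_eq.
- apply: is_gr_eq; [by solve_gr..|].
  by move=> x; exact: cV0_eq.
- apply: is_gr_eq; [by solve_gr..|].
  by move=> x; exact: cV0_eq.
Defined.

End CxBiFn.

Section ConcaveBifunctions.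
Variable R : realType.
Implicit Types m n : nat.
Local Open Scope ereal_scope.

Record cvbifn m n := CvBifn {
  cvbifn_fun :> 'cV[R]_m -> 'cV[R]_n -> \bar R;
  cvbifn_ccv : @ccv_fun R ('cV[R]_m * 'cV[R]_n)%type
                 (fun p => cvbifn_fun p.1 p.2)
}.

Definition cvneg m n (F : cvbifn m n) : cxbifn R m n :=
  CxBifn (cxbifn_fun := fun x y => - F x y) (@cvbifn_ccv _ _ F).

Lemma cvbifnP m n (F G : cvbifn m n) : (forall x y, F x y = G x y) -> F = G.
Proof.
case: F G => [F cF] [G cG]/= FG.
have {}FG : F = G by apply/funext => x; apply/funext => y.
by case: G / FG cG => cG; congr CvBifn; exact: Prop_irrelevance.
Qed.

Lemma cvneg_inj m n : injective (@cvneg m n).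
Proof.
move=> F G FG; apply: cvbifnP => x y; apply: oppe_inj.
by have := congr1 (fun H : cxbifn R m n => H x y) FG.
Qed.

Lemma ccv_eq m n (F : 'cV[R]_m -> 'cV[R]_n -> \bar R) (G : cxbifn R m n) :
  (forall x y, - F x y = G x y) ->
  @ccv_fun R ('cV[R]_m * 'cV[R]_n)%type (fun p => F p.1 p.2).
Proof.
move=> FG; rewrite /ccv_fun; have := @cxbifn_cvx _ _ _ G.
by congr cvx_fun; apply/funext => -[x y]/=; rewrite FG.
Qed.

Lemma oppe_sup (T : Type) (f : T -> \bar R) :
  - ereal_sup [set f y | y in setT] = ereal_inf [set - f y | y in setT].
Proof. by rewrite ereal_supEN oppeK image_comp. Qed.

Lemma oppe_add (x y : \bar R) : - (x + y) = (- x + - y)%dE.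
Proof. by case: x => [x| |]; case: y => [y| |] //=; rewrite opprD. Qed.

Fact cvid_ccv n :
  @ccv_fun R ('cV[R]_n * 'cV[R]_n)%type (fun p => - ind R (p.1 = p.2)).
Proof.
by apply: (@ccv_eq _ _ (fun x y => - ind R (x = y)) (cxid R n)) => x y /=; rewrite oppeK.
Qed.

Definition cvid n : cvbifn n n :=
  @CvBifn n n (fun x y => - ind R (x = y)) (@cvid_ccv n).

Lemma cvcomp_neg m n p (F : cvbifn n p) (G : cvbifn m n) x z :
  - ereal_sup [set G x y + F y z | y in [set: 'cV[R]_n]] =
  cxcomp (cvneg F) (cvneg G) x z.
Proof.
rewrite oppe_sup /=; congr ereal_inf.
by apply/seteqP; split => _ [y _ <-]; exists y => //; rewrite oppe_add.
Qed.

Definition cvcomp m n p (F : cvbifn n p) (G : cvbifn m n) : cvbifn m p :=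
  CvBifn (cvbifn_fun := fun x z =>
    ereal_sup [set G x y + F y z | y in [set: 'cV[R]_n]])
    (@ccv_eq _ _ _ _ (cvcomp_neg F G)).

Lemma cvtens_neg m m' n n' (F : cvbifn m m') (G : cvbifn n n') x y :
  - (F (usubmx x) (usubmx y) + G (dsubmx x) (dsubmx y)) =
  cxtens (cvneg F) (cvneg G) x y.
Proof. by rewrite oppe_add. Qed.

Definition cvtens m m' n n' (F : cvbifn m m') (G : cvbifn n n') :
    cvbifn (m + n) (m' + n') :=
  CvBifn (cvbifn_fun := fun x y =>
    F (usubmx x) (usubmx y) + G (dsubmx x) (dsubmx y))
    (@ccv_eq _ _ _ _ (cvtens_neg F G)).

Fact cvsymm_neg m n x y :
  - - ind R (usubmx x = dsubmx y /\ dsubmx x = usubmx y) = cxsymm R m n x y.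
Proof. by rewrite oppeK. Qed.

Definition cvsymm m n : cvbifn (m + n) (n + m) :=
  CvBifn (cvbifn_fun := fun x y =>
    - ind R (usubmx x = dsubmx y /\ dsubmx x = usubmx y))
    (@ccv_eq _ _ _ _ (@cvsymm_neg m n)).

Fact cvadd_ccv n :
  @ccv_fun R ('cV[R]_(n + n) * 'cV[R]_n)%type (fun q =>
    - ind R (usubmx q.1 + dsubmx q.1 = q.2)%R).
Proof.
rewrite /ccv_fun; under [fun q => _]eq_fun do rewrite oppeK.
apply: (@cvx_ind R ('cV[R]_(n + n) * 'cV[R]_n)%type) => a x y /=.
by rewrite !linearD !linearZ/= => <- <-; rewrite !scalerDr addrACA.
Qed.

Definition cvadd n : cvbifn (n + n) n :=
  CvBifn (cvbifn_fun := fun p z => - ind R (usubmx p + dsubmx p = z)%R)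
    (@cvadd_ccv n).

Fact cvzero_ccv n :
  @ccv_fun R ('cV[R]_0 * 'cV[R]_n)%type (fun q => - ind R (q.2 = 0%R)).
Proof.
rewrite /ccv_fun; under [fun q => _]eq_fun do rewrite oppeK.
apply: (@cvx_ind R ('cV[R]_0 * 'cV[R]_n)%type) => a x y /= -> ->.
by rewrite !scaler0 addr0.
Qed.

Definition cvzero n : cvbifn 0 n :=
  CvBifn (cvbifn_fun := fun _ x => - ind R (x = 0%R)) (@cvzero_ccv n).

Lemma cvneg_id n : cvneg (cvid n) = cxid R n.
Proof. by apply: cxbifnP => x y /=; rewrite oppeK. Qed.

Lemma cvneg_comp m n p (F : cvbifn n p) (G : cvbifn m n) :
  cvneg (cvcomp F G) = cxcomp (cvneg F) (cvneg G).
Proof. by apply: cxbifnP => x y /=; rewrite cvcomp_neg. Qed.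

Lemma cvneg_tens m m' n n' (F : cvbifn m m') (G : cvbifn n n') :
  cvneg (cvtens F G) = cxtens (cvneg F) (cvneg G).
Proof. by apply: cxbifnP => x y /=; rewrite cvtens_neg. Qed.

Lemma cvneg_symm m n : cvneg (cvsymm m n) = cxsymm R m n.
Proof. by apply: cxbifnP => x y /=; rewrite oppeK. Qed.

Lemma cvneg_idto m n (e : m = n) :
  cvneg (idto_of (hom := cvbifn) cvid e) =
  idto_of (hom := cxbifn R) (cxid R) e.
Proof. by case: n / e; exact: cvneg_id. Qed.

Lemma is_gr_negadd n : is_gr (cvneg (cvadd n)) (fun p => usubmx p + dsubmx p)%R.
Proof. by move=> x y /=; rewrite oppeK; congr ind; apply/propext; split. Qed.

Lemma is_gr_negzero n : is_gr (cvneg (cvzero n)) (fun=> 0%R).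
Proof. by move=> x y /=; rewrite oppeK. Qed.

End ConcaveBifunctions.

Section CvBiFn.
Variable R : realType.

Let negE := (@cvneg_comp R, @cvneg_tens R, @cvneg_id R, @cvneg_symm R,
  @cvneg_idto R).

Let grE := (@col_mxKu R, @col_mxKd R, vcastA, vcastAV, vcast0n, vcastn0,
  @fsumE R, vcast_id).

Definition CvBiFn : smcat.
refine (@SMCat nat (@cvbifn R) (@cvid R) (@cvcomp R)
  addn 0%N (@cvtens R) (@cvsymm R) addnA add0n addn0
  _ _ _ _ _ _ _ _ _ _ _); intros; apply: cvneg_inj; rewrite !negE.
- exact: (@smcompA (CxBiFn R)).
- exact: (@smcomp1 (CxBiFn R)).
- exact: (@smcomp1r (CxBiFn R)).
- exact: (@smtensm1 (CxBiFn R)).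
- exact: (@smtensm_comp (CxBiFn R)).
- exact: (@smtensmA (CxBiFn R)).
- exact: (@smtensm1l (CxBiFn R)).
- exact: (@smtensm1r (CxBiFn R)).
- exact: (@smsymm_nat (CxBiFn R)).
- exact: (@smsymmK (CxBiFn R)).
- exact: (@smhexagon (CxBiFn R)).
Defined.

Lemma idto_op (C : smcat) (X Y : opcat C) (e : X = Y) :
  idto e = @idto C Y X (esym e).
Proof. by case: Y / e. Qed.

Ltac solve_neg_gr :=
  repeat first [ apply: is_gr_comp | apply: is_gr_tens | exact: is_gr_id
               | exact: is_gr_symm | exact: is_gr_idto | exact: is_gr_negadd
               | exact: is_gr_negzero ].

(* In the opposite category [cvadd n : cvbifn R (n + n) n] is a morphism from n
   to n + n, and [cvzero n : cvbifn R 0 n] a morphism from n to 0. *)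
Definition CvBiFn_op_cd : cdcat.
refine (@CDCat (opcat CvBiFn) (@cvadd R) (@cvzero R) _ _ _ _ _ _ _ _);
  intros; rewrite ?idto_op /idto; apply: cvneg_inj; rewrite /= !negE;
  (apply: is_gr_eq; [by solve_neg_gr..|]).
- elim/colI; elim/colI => a b c /=; do 3 rewrite ?grE/=.
  by rewrite addrA.
- by move=> x /=; rewrite (vcast0nV _ 0) !grE add0r.
- by move=> x /=; rewrite (vcastn0V _ _ 0) !grE addr0.
- by elim/colI => a b /=; rewrite !grE addrC.
- elim/colI; elim/colI => a b; elim/colI => c d /=.
  by do 4 rewrite ?grE/=; rewrite add_col_mx.
- by move=> x /=; rewrite /fsum col_mx0.
- by move=> x; exact: cV0_eq.
- by move=> x; exact: cV0_eq.
Defined.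

End CvBiFn.

Section Adjoints.
Variable R : realType.
Implicit Types m n : nat.
Local Open Scope ereal_scope.

Definition dot n (x y : 'cV[R]_n) : R := (\sum_i x i 0 * y i 0)%R.

Lemma dotDl n (a b : R) (u v x : 'cV[R]_n) :
  dot (a *: u + b *: v)%R x = (a * dot u x + b * dot v x)%R.
Proof.
rewrite /dot !mulr_sumr -big_split/=; apply: eq_bigr => i _.
by rewrite !mxE; ring.
Qed.

Fact cxadj_ccv m n (F : cxbifn R m n) :
  @ccv_fun R ('cV[R]_n * 'cV[R]_m)%type (fun q =>
    ereal_inf [set (F x y + (dot q.2 x)%:E - (dot q.1 y)%:E)%dE |
      x in [set: 'cV[R]_m] & y in [set: 'cV[R]_n]]).
Proof.
apply/cvx_funP => t [y1 x1] [y2 x2] a b t0 t1 /=.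
rewrite leeNl => /ereal_infP ha; rewrite leeNl => /ereal_infP hb.
rewrite leeNl; apply/ereal_infP => _ [x _ [y _ <-]].
have := hb _ (ex_intro2 _ _ x I (ex_intro2 _ _ y I erefl)).
have := ha _ (ex_intro2 _ _ x I (ex_intro2 _ _ y I erefl)).
case: (F x y) => [r| |]; [|by rewrite !leey|by []].
have fE u v : (r%:E + u%:E - v%:E)%dE = (r + u - v)%:E :> \bar R by [].
rewrite !fE -!EFinN !lee_fin !dotDl => h1 h2.
have {}h1 : (t * - a <= t * (r + dot x1 x - dot y1 y))%R by rewrite ler_pM2l.
have {}h2 : ((1 - t) * - b <= (1 - t) * (r + dot x2 x - dot y2 y))%R.
  by rewrite ler_pM2l// subr_gt0.
by lra.
Qed.

Definition cxadj m n (F : cxbifn R m n) : cvbifn R n m :=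
  CvBifn (cvbifn_fun := fun ys xs =>
    ereal_inf [set (F x y + (dot xs x)%:E - (dot ys y)%:E)%dE |
      x in [set: 'cV[R]_m] & y in [set: 'cV[R]_n]])
    (@cxadj_ccv _ _ F).

Fact cvadj_cvx m n (G : cvbifn R n m) :
  @cvx_fun R ('cV[R]_m * 'cV[R]_n)%type (fun q =>
    ereal_sup [set G y x + (dot q.2 y)%:E - (dot q.1 x)%:E |
      y in [set: 'cV[R]_n] & x in [set: 'cV[R]_m]]).
Proof.
apply/cvx_funP => t [x1 y1] [x2 y2] a b t0 t1 /=.
move=> /ereal_supP ha /ereal_supP hb.
apply/ereal_supP => _ [y _ [x _ <-]].
have := hb _ (ex_intro2 _ _ y I (ex_intro2 _ _ x I erefl)).
have := ha _ (ex_intro2 _ _ y I (ex_intro2 _ _ x I erefl)).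
case: (G y x) => [r| |]; [|by []|by rewrite !leNye].
rewrite -!EFinD !lee_fin !dotDl => h1 h2.
have {}h1 : (t * (r + dot y1 y - dot x1 x) <= t * a)%R by rewrite ler_pM2l.
have {}h2 : ((1 - t) * (r + dot y2 y - dot x2 x) <= (1 - t) * b)%R.
  by rewrite ler_pM2l// subr_gt0.
by lra.
Qed.

Definition cvadj m n (G : cvbifn R n m) : cxbifn R m n :=
  CxBifn (cxbifn_fun := fun xs ys =>
    ereal_sup [set G y x + (dot ys y)%:E - (dot xs x)%:E |
      y in [set: 'cV[R]_n] & x in [set: 'cV[R]_m]])
    (@cvadj_cvx _ _ G).

(* transpose of a linear map, through its matrix in the standard bases *)
Definition std_mx m n (A : 'Hom('cV[R]_m, 'cV[R]_n)) : 'M[R]_(n, m) :=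
  \matrix_(i, j) A (delta_mx j 0%R) i 0%R.

Definition lin_tr m n (A : 'Hom('cV[R]_m, 'cV[R]_n)) :
    'Hom('cV[R]_n, 'cV[R]_m) :=
  linfun (mulmx (std_mx A)^T).

End Adjoints.

(* Main.v *)
Require Import Defs.
From mathcomp Require Import all_boot all_order all_algebra.
From mathcomp Require Import all_classical all_reals.
From mathcomp Require Import ereal.

(** Both [F_A] and [- G_A] are indicators of graphs: of [A], and of its
    transpose [lin_tr A]. Graph indicators compose and tensor as the underlying
    functions do ([is_gr_comp], [is_gr_tens]) and determine them ([is_gr_eq]), so
    every functor equation becomes an equation between linear maps. For [F] this
    equation is immediate. For [G] it says that transposition is contravariant,
    preserves direct sums, sends the swap to the opposite swap, the diagonal to
    addition and the map to [R^0] to the zero map; all this follows from the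
    characterization of the transpose by <A^T y, x> = <y, A x>
    ([dot_lin_tr], [lin_tr_unique]).

    For the adjoints, the indicator restricts the infimum defining [(F_A)^*] to
    the graph of [A], which leaves
    [inf_x (<x*, x> - <y*, A x>) = inf_x <x* - A^T y*, x>].
    A linear form is bounded below only if it vanishes, so this is
    [- {|x* = A^T y*|}] ([inf_dot]). Dually, [(G_A)^*] reduces to
    [sup_y <y* - A x*, y>], which is [{|y* = A x*|}] ([sup_dot]). *)

Set Implicit Arguments.
Unset Strict Implicit.
Unset Printing Implicit Defensive.

Import Order.TTheory GRing.Theory Num.Theory.
Local Open Scope classical_set_scope.
Local Open Scope ring_scope.

(** * The inner product *)

Section Dot.
Variable R : realType.
Implicit Types m n : nat.

Lemma dotC n (x y : 'cV[R]_n) : dot x y = dot y x.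
Proof. by apply: eq_bigr => i _; rewrite mulrC. Qed.

Lemma dotE n (x y : 'cV[R]_n) : dot x y = (x^T *m y) 0 0.
Proof. by rewrite mxE; apply: eq_bigr => i _; rewrite mxE. Qed.

Lemma dotBl n (x y z : 'cV[R]_n) : dot (x - y) z = dot x z - dot y z.
Proof. by have := dotDl 1 (-1) x y z; rewrite scale1r scaleN1r mul1r mulN1r. Qed.

Lemma dot0l n (x : 'cV[R]_n) : dot 0 x = 0.
Proof. by rewrite -(subrr x) dotBl subrr. Qed.

Lemma dotZr n (a : R) (x y : 'cV[R]_n) : dot x (a *: y) = a * dot x y.
Proof. by rewrite !dotE -scalemxAr mxE. Qed.

Lemma dotNr n (x y : 'cV[R]_n) : dot x (- y) = - dot x y.
Proof. by rewrite -scaleN1r dotZr mulN1r. Qed.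

Lemma dot_self_eq0 n (x : 'cV[R]_n) : dot x x = 0 -> x = 0.
Proof.
move=> /eqP; rewrite psumr_eq0 => [/allP x0|i _]; last exact: sqr_ge0.
apply/matrixP => i j; rewrite ord1 mxE; apply/eqP.
by have := x0 i (mem_index_enum i); rewrite mulf_eq0 orbb.
Qed.

Lemma dot_nondegenerate n (x y : 'cV[R]_n) :
  (forall z, dot x z = dot y z) -> x = y.
Proof. by move=> xy; apply/subr0_eq/dot_self_eq0; rewrite dotBl xy subrr. Qed.

Lemma dot_col_mx m n (a c : 'cV[R]_m) (b d : 'cV[R]_n) :
  dot (col_mx a b) (col_mx c d) = dot a c + dot b d.
Proof. by rewrite !dotE tr_col_mx mul_row_col mxE. Qed.

End Dot.

(** * Transposes of linear maps *)

Section Transpose.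
Variable R : realType.
Implicit Types m n : nat.

Lemma std_mxE m n (A : 'Hom('cV[R]_m, 'cV[R]_n)) x : std_mx A *m x = A x.
Proof.
rewrite [in RHS](matrix_sum_delta x) linear_sum /=.
apply/matrixP => i j; rewrite mxE summxE; apply: eq_bigr => k _.
by rewrite big_ord1 linearZ !mxE mulrC (ord1 j).
Qed.

Lemma dot_lin_tr m n (A : 'Hom('cV[R]_m, 'cV[R]_n)) x y :
  dot (lin_tr A y) x = dot y (A x).
Proof. by rewrite lfunE/= -(std_mxE A) !dotE trmx_mul trmxK mulmxA. Qed.

Lemma lin_tr_unique m n (A : 'Hom('cV[R]_m, 'cV[R]_n)) f :
  (forall x y, dot (f y) x = dot y (A x)) -> lin_tr A =1 f.
Proof.
by move=> fA y; apply: dot_nondegenerate => x; rewrite dot_lin_tr fA.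
Qed.

Lemma lin_tr_id n : lin_tr \1%VF =1 @id 'cV[R]_n.
Proof. by apply: lin_tr_unique => x y; rewrite id_lfunE. Qed.

Lemma lin_tr_comp m n p (B : 'Hom('cV[R]_n, 'cV[R]_p))
    (A : 'Hom('cV[R]_m, 'cV[R]_n)) :
  lin_tr (B \o A)%VF =1 lin_tr A \o lin_tr B.
Proof. by apply: lin_tr_unique => x y /=; rewrite comp_lfunE !dot_lin_tr. Qed.

Lemma lin_tr_dsum m m' n n' (A : 'Hom('cV[R]_m, 'cV[R]_m'))
    (B : 'Hom('cV[R]_n, 'cV[R]_n')) :
  lin_tr (lin_dsum A B) =1 fsum (lin_tr A) (lin_tr B).
Proof.
apply: lin_tr_unique; elim/colI => a b; elim/colI => c d.
by rewrite fsumE lin_dsumE !dot_col_mx !dot_lin_tr.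
Qed.

Lemma lin_tr_swap m n :
  lin_tr (lin_swap R m n) =1 fun x => col_mx (dsubmx x) (usubmx x).
Proof.
apply: lin_tr_unique; elim/colI => a b; elim/colI => c d.
by rewrite lin_swapE col_mxKu col_mxKd !dot_col_mx addrC.
Qed.

Lemma lin_tr_diag n :
  lin_tr (linfun (@diag_fun R n)) =1 fun x => usubmx x + dsubmx x.
Proof.
apply: lin_tr_unique => x; elim/colI => a b.
rewrite lin_diagE col_mxKu col_mxKd dot_col_mx.
by rewrite -[b in a + b]opprK dotBl !(dotC _ x) dotNr opprK.
Qed.

Lemma lin_tr0 m n : lin_tr (0 : 'Hom('cV[R]_m, 'cV[R]_n)) =1 fun=> 0.
Proof. by apply: lin_tr_unique => x y; rewrite zero_lfunE dot0l dotC dot0l. Qed.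

End Transpose.

(** * Graph bifunctions of linear maps *)

Section Graphs.
Variable R : realType.
Implicit Types m n : nat.

Fact cxgraph_cvx m n (A : 'Hom('cV[R]_m, 'cV[R]_n)) :
  @cvx_fun R ('cV[R]_m * 'cV[R]_n)%type (fun p => ind R (p.2 = A p.1)).
Proof.
apply: (@cvx_ind R ('cV[R]_m * 'cV[R]_n)%type) => a x y /= -> ->.
by rewrite linearD !linearZ.
Qed.

(** The convex bifunction [F_A]. *)
Definition cxgraph m n (A : 'Hom('cV[R]_m, 'cV[R]_n)) : cxbifn R m n :=
  CxBifn (cxbifn_fun := fun x y => ind R (y = A x)) (@cxgraph_cvx m n A).

Fact cvgraph_neg m n (A : 'Hom('cV[R]_m, 'cV[R]_n)) y x :
  (- - ind R (x = lin_tr A y))%E = cxgraph (lin_tr A) y x.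
Proof. by rewrite oppeK. Qed.

(** The concave bifunction [G_A], which goes in the direction opposite to [A]. *)
Definition cvgraph m n (A : 'Hom('cV[R]_m, 'cV[R]_n)) : cvbifn R n m :=
  CvBifn (cvbifn_fun := fun y x => (- ind R (x = lin_tr A y))%E)
    (ccv_eq (@cvgraph_neg m n A)).

Lemma is_gr_cxgraph m n (A : 'Hom('cV[R]_m, 'cV[R]_n)) : is_gr (cxgraph A) A.
Proof. by []. Qed.

Lemma is_gr_cvgraph m n (A : 'Hom('cV[R]_m, 'cV[R]_n)) :
  is_gr (cvneg (cvgraph A)) (lin_tr A).
Proof. by move=> y x /=; rewrite oppeK. Qed.

End Graphs.

(** * Functoriality *)

Section Functors.
Variable R : realType.

Lemma cxgraph_cdfunctor :
  @is_cdfunctor (Vect_cd R) (CxBiFn_cd R) (fun n : nat => n) (@cxgraph R).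
Proof.
(* objects are preserved on the nose, so every [idto] is an identity *)
apply: (@IsCDFunctor _ _ _ _ _ _ (fun _ _ => erefl) erefl).
- move=> n; apply: (is_gr_eq (@is_gr_cxgraph R _ _ _) (@is_gr_id R n)) => x.
  exact: id_lfunE.
- move=> m n p B A; apply: (is_gr_eq (@is_gr_cxgraph R _ _ _)
    (is_gr_comp (@is_gr_cxgraph R _ _ B) (@is_gr_cxgraph R _ _ A))) => x.
  exact: comp_lfunE.
- move=> m m' n n' A B; rewrite [LHS]smcomp1 [RHS]smcomp1r.
  apply: (is_gr_eq (@is_gr_cxgraph R _ _ _)
    (is_gr_tens (@is_gr_cxgraph R _ _ A) (@is_gr_cxgraph R _ _ B))).
  by elim/colI => a b; rewrite lin_dsumE fsumE.
- move=> m n; rewrite [LHS]smcomp1 [RHS]smcomp1r.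
  apply: (is_gr_eq (@is_gr_cxgraph R _ _ _) (@is_gr_symm R m n)).
  by elim/colI => a b; rewrite lin_swapE col_mxKu col_mxKd.
- move=> n; rewrite [LHS]smcomp1.
  apply: (is_gr_eq (@is_gr_cxgraph R _ _ _) (@is_gr_copy R n)) => x.
  exact: lin_diagE.
- move=> n; rewrite [LHS]smcomp1.
  apply: (is_gr_eq (@is_gr_cxgraph R _ _ _) (@is_gr_discard R n)) => x.
  exact: cV0_eq.
Qed.

Lemma cvgraph_cdfunctor :
  @is_cdfunctor (Vect_cd R) (CvBiFn_op_cd R) (fun n : nat => n) (@cvgraph R).
Proof.
(* objects are preserved on the nose, so every [idto] is an identity *)
apply: (@IsCDFunctor _ _ _ _ _ _ (fun _ _ => erefl) erefl).
- move=> n; apply: cvneg_inj; rewrite /= cvneg_id.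
  exact: (is_gr_eq (@is_gr_cvgraph R _ _ _) (@is_gr_id R n) (@lin_tr_id R n)).
- move=> m n p B A; apply: cvneg_inj; rewrite /= cvneg_comp.
  exact: (is_gr_eq (@is_gr_cvgraph R _ _ _)
    (is_gr_comp (@is_gr_cvgraph R _ _ A) (@is_gr_cvgraph R _ _ B))
    (lin_tr_comp B A)).
- move=> m m' n n' A B; rewrite [LHS]smcomp1 [RHS]smcomp1r.
  apply: cvneg_inj; rewrite /= cvneg_tens.
  exact: (is_gr_eq (@is_gr_cvgraph R _ _ _)
    (is_gr_tens (@is_gr_cvgraph R _ _ A) (@is_gr_cvgraph R _ _ B))
    (lin_tr_dsum A B)).
- move=> m n; rewrite [LHS]smcomp1 [RHS]smcomp1r.
  apply: cvneg_inj; rewrite /= cvneg_symm.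
  exact: (is_gr_eq (@is_gr_cvgraph R _ _ _) (@is_gr_symm R n m)
    (@lin_tr_swap R m n)).
- move=> n; rewrite [LHS]smcomp1; apply: cvneg_inj.
  exact: (is_gr_eq (@is_gr_cvgraph R _ _ _) (@is_gr_negadd R n)
    (@lin_tr_diag R n)).
- move=> n; rewrite [LHS]smcomp1; apply: cvneg_inj.
  exact: (is_gr_eq (@is_gr_cvgraph R _ _ _) (@is_gr_negzero R n)
    (@lin_tr0 R n 0)).
Qed.

End Functors.

(** * Adjoints *)

Section AdjointGraphs.
Variable R : realType.
Implicit Types m n : nat.
Local Open Scope ereal_scope.

Lemma inf_dot n (v : 'cV[R]_n) :
  ereal_inf [set (dot v x)%:E | x in setT] = - ind R (v = 0%R).
Proof.
have [->|v0] := pselect (v = 0%R).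
  rewrite indT// oppe0; apply/le_anti/andP; split.
    by apply: ereal_inf_lbound; exists 0%R => //; rewrite dot0l.
  by apply/le_infP => x; rewrite dot0l.
rewrite indF//; apply: eq_ninfty => r.
have vv0 : dot v v != 0%R by apply/eqP => /dot_self_eq0.
(* the linear form takes the value [r] on the line spanned by [v] *)
apply: ereal_inf_lbound; exists ((r / dot v v) *: v)%R => //.
by rewrite dotZr divfK.
Qed.

Lemma sup_dot n (v : 'cV[R]_n) :
  ereal_sup [set (dot v x)%:E | x in setT] = ind R (v = 0%R).
Proof.
apply: oppe_inj; rewrite oppe_sup -inf_dot; congr ereal_inf.
apply/seteqP; split => _ [x _ <-]; exists (- x)%R => //; rewrite dotNr//.
by rewrite EFinN oppeK.
Qed.

Lemma dsub_EFin (a b : R) : (a%:E - b%:E)%dE = (a - b)%:E :> \bar R.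
Proof. by []. Qed.

Lemma cxadj_cxgraph m n (A : 'Hom('cV[R]_m, 'cV[R]_n)) :
  cxadj (cxgraph A) = cvgraph A.
Proof.
apply: cvbifnP => ys xs /=.
have -> : (xs = lin_tr A ys) = (xs - lin_tr A ys = 0)%R.
  by apply/propext; split=> [->|/subr0_eq//]; rewrite subrr.
rewrite -inf_dot; apply: eq_ereal_lb => c; apply/idP/idP.
  move=> /ereal_infP h; apply/le_infP => x.
  have := h _ (ex_intro2 _ _ x I (ex_intro2 _ _ (A x) I erefl)).
  by rewrite indT// dadd0E dsub_EFin dotBl dot_lin_tr.
move=> /le_infP h; apply/ereal_infP => _ [x _ [y _ <-]].
have [->|yA] := pselect (y = A x); last by rewrite indF// !daddy leey.
by rewrite indT// dadd0E dsub_EFin; have := h x; rewrite dotBl dot_lin_tr.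
Qed.

Lemma cvadj_cvgraph m n (A : 'Hom('cV[R]_m, 'cV[R]_n)) :
  cvadj (cvgraph A) = cxgraph A.
Proof.
apply: cxbifnP => xs ys /=.
have -> : (ys = A xs) = (ys - A xs = 0)%R.
  by apply/propext; split=> [->|/subr0_eq//]; rewrite subrr.
have E y : (dot ys y - dot xs (lin_tr A y) = dot (ys - A xs) y)%R.
  by rewrite dotBl (dotC xs) dot_lin_tr (dotC y).
rewrite -sup_dot; apply/le_anti/andP; split.
  apply/ereal_supP => _ [y _ [x _ <-]].
  have [->|xA] := pselect (x = lin_tr A y); last by rewrite indF// leNye.
  rewrite indT// oppe0 add0e -EFinB E.
  by apply: ereal_sup_ubound; exists y.
apply/ereal_supP => _ [y _ <-]; apply: ereal_sup_ubound.
exists y => //; exists (lin_tr A y) => //.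
by rewrite indT// oppe0 add0e -EFinB E.
Qed.

End AdjointGraphs.

Theorem theorem3 (R : realType) :
  exists (F : forall m n : nat,
            'Hom('cV[R]_m, 'cV[R]_n) -> cxbifn R m n)
         (G : forall m n : nat,
            'Hom('cV[R]_m, 'cV[R]_n) -> cvbifn R n m),
    (forall m n (A : 'Hom('cV[R]_m, 'cV[R]_n)) (x : 'cV[R]_m) (y : 'cV[R]_n),
       F m n A x y = ind R (y = A x)) /\
    (forall m n (A : 'Hom('cV[R]_m, 'cV[R]_n)) (y : 'cV[R]_n) (x : 'cV[R]_m),
       G m n A y x = (- ind R (x = lin_tr A y))%E) /\
    @is_cdfunctor (Vect_cd R) (CxBiFn_cd R) (fun n : nat => n) F /\
    @is_cdfunctor (Vect_cd R) (CvBiFn_op_cd R) (fun n : nat => n) G /\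
    (forall m n (A : 'Hom('cV[R]_m, 'cV[R]_n)),
       cxadj (F m n A) = G m n A /\ cvadj (G m n A) = F m n A).
Proof.
exists (@cxgraph R), (@cvgraph R); do 2 split => //.
split; first exact: cxgraph_cdfunctor.
split; first exact: cvgraph_cdfunctor.
by move=> m n A; split; [exact: cxadj_cxgraph|exact: cvadj_cvgraph].
Qed.
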